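(* Fix a positive integer $d$ and $p\in(0,\frac12]$. For all $n$ large enough the following holds. If $X_1,\dots,X_n$ are independent Bernoulli random variables with parameter $p$, $a_1,\dots,a_n\in\mathbb{R}^d\setminus\{0\}$ and $x\in\mathbb{R}^d$, then $$\mathbb{P}\Big(\sum_{i=1}^n a_iX_i=x\Big)\le\max_{0\le k\le n}\ \max_{x'\in\{\lfloor\mu_k\rfloor,\lceil\mu_k\rceil\}}\mathbb{P}(B_{n-k,p}-B'_{k,p}=x'),$$ where $B_{n-k,p}$ and $B'_{k,p}$ are independent binomial random variables with parameters $(n-k,p)$ and $(k,p)$ respectively, and $\mu_k=(n-2k)p=\mathbb{E}B_{n-k,p}-\mathbb{E}B'_{k,p}$.
   Context: A Bernoulli random variable with parameter $p$ takes value $1$ with probability $p$ and $0$ with probability $1-p$. ''Large enough'' means $n\ge n_0$ for some threshold $n_0$ that may depend on the fixed $d$ and $p$ but not on $a_1,\dots,a_n$ or $x$. *)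

(* Defs.v *)
From mathcomp Require Export all_boot all_order all_algebra.
From mathcomp Require Export all_classical all_reals all_analysis.
Export Order.TTheory GRing.Theory Num.Theory numFieldNormedType.Exports.

Set Implicit Arguments.
Unset Strict Implicit.
Unset Printing Implicit Defensive.

Local Open Scope classical_set_scope.
Local Open Scope ring_scope.

Definition mutually_independent (d d' : measure_display)
    (T : measurableType d) (T' : measurableType d') (R : realType)
    (P : probability T R) (I : finType) (X : I -> {RV P >-> T'}) : Prop :=
  forall (J : {set I}) (A : I -> set T'),
    (forall i, i \in J -> measurable (A i)) ->
    P (\bigcap_(i in [set` J]) (X i @^-1` A i)) =
    (\prod_(i in J) P (X i @^-1` A i))%E.

Definition independent2 (d d1 d2 : measure_display)
    (T : measurableType d) (T1 : measurableType d1) (T2 : measurableType d2)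
    (R : realType) (P : probability T R)
    (X : {RV P >-> T1}) (Y : {RV P >-> T2}) : Prop :=
  forall (A : set T1) (B : set T2), measurable A -> measurable B ->
    P (X @^-1` A `&` Y @^-1` B) = (P (X @^-1` A) * P (Y @^-1` B))%E.

(* The variable is real-valued, so it lies in {0, 1} only almost surely. *)
Definition bernoulli_RV (d : measure_display) (T : measurableType d)
    (R : realType) (P : probability T R) (X : {RV P >-> R}) (p : R) : Prop :=
  P [set w | X w = 1] = p%:E /\ P [set w | X w = 0] = (1 - p)%:E.

Definition binomial_RV (d : measure_display) (T : measurableType d)
    (R : realType) (P : probability T R) (B : {RV P >-> nat})
    (n : nat) (p : R) : Prop :=
  distribution P B = binomial_prob n p :> (set nat -> \bar R).

(* Main.v *)
Require Import Defs.
From mathcomp Require Import lra ring zify.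

Set Implicit Arguments.
Unset Strict Implicit.
Unset Printing Implicit Defensive.

Local Open Scope classical_set_scope.
Local Open Scope ring_scope.

(** The bound holds for every n. A linear functional that is nonzero on all a_i
    reduces the problem to nonzero reals b_i; replacing X_i by 1 - X_i where
    b_i < 0 makes all coefficients positive, so the event becomes an antichain
    of the cube {0,1}^n under a product measure with k parameters 1 - p and
    n - k parameters p. By a weighted LYM inequality, which rests on the
    log-concavity of the Poisson binomial law, an antichain has at most the
    measure of the heaviest level {sum = j}. Darroch's theorem places the
    heaviest level at the floor or the ceiling of the mean; it is obtained from
    Hoeffding's observation that, at a fixed mean, a linear functional of the
    Poisson binomial law is minimized at a shifted binomial law. *)

(** * The Poisson binomial generating function *)

Section PGF.
Variable R : realFieldType.
Implicit Types (l : seq R) (q : R).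

Definition bern_factor q : {poly R} := (1 - q)%:P + q *: 'X.
Definition bern_pgf l : {poly R} := \prod_(q <- l) bern_factor q.

Lemma bern_pgf_cons q l : bern_pgf (q :: l) = bern_factor q * bern_pgf l.
Proof. by rewrite /bern_pgf big_cons. Qed.

Lemma coef_bern_factor_mul0 q (f : {poly R}) :
  (bern_factor q * f)`_0 = (1 - q) * f`_0.
Proof.
by rewrite mulrDl coefD coefCM -scalerAl coefZ coefXM mulr0 addr0.
Qed.

Lemma coef_bern_factor_mulS q (f : {poly R}) j :
  (bern_factor q * f)`_j.+1 = (1 - q) * f`_j.+1 + q * f`_j.
Proof. by rewrite mulrDl coefD coefCM -scalerAl coefZ coefXM. Qed.

Lemma bern_pgf_ge0 l j : all (fun q => 0 <= q <= 1) l -> 0 <= (bern_pgf l)`_j.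
Proof.
elim: l j => [|q l IH] j /=; first by rewrite /bern_pgf big_nil coef1 ler0n.
case/andP=> /andP[q0 q1] hl; rewrite bern_pgf_cons; case: j => [|j].
  by rewrite coef_bern_factor_mul0 mulr_ge0 ?subr_ge0// IH.
rewrite coef_bern_factor_mulS addr_ge0// mulr_ge0 ?subr_ge0// IH//.
Qed.

Lemma bern_pgf_gt0 l j : all (fun q => 0 < q < 1) l -> (j <= size l)%N ->
  0 < (bern_pgf l)`_j.
Proof.
elim: l j => [|q l IH] j /=; first by rewrite leqn0 => _ /eqP->; rewrite /bern_pgf big_nil coef1.
case/andP=> /andP[q0 q1] hl; rewrite bern_pgf_cons; case: j => [|j] jl.
  by rewrite coef_bern_factor_mul0 mulr_gt0 ?subr_gt0// IH.
have hl' : all (fun q => 0 <= q <= 1) l by apply: sub_all hl => x /andP[? ?]; rewrite !ltW.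
rewrite coef_bern_factor_mulS ltr_wpDl//; last by rewrite mulr_gt0 ?IH.
by rewrite mulr_ge0 ?subr_ge0 ?(ltW q1)// bern_pgf_ge0.
Qed.

Lemma bern_pgf_gt_size l j : (size l < j)%N -> (bern_pgf l)`_j = 0.
Proof.
elim: l j => [|q l IH] [|j]//= jl.
  by rewrite /bern_pgf big_nil coef1.
by rewrite bern_pgf_cons coef_bern_factor_mulS !IH ?mulr0 ?addr0// ltnW.
Qed.

(** The form with two indices [i <= j], rather than [i = j] alone, is what the induction on [l]
    consumes. Products instead of ratios allow vanishing coefficients, as [q] may be 0 or 1. *)
Lemma bern_pgf_log_concave l i j : all (fun q => 0 <= q <= 1) l -> (i <= j)%N ->
  (bern_pgf l)`_i * (bern_pgf l)`_j.+2 <= (bern_pgf l)`_i.+1 * (bern_pgf l)`_j.+1.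
Proof.
elim: l i j => [|q l IH] i j /=.
  by rewrite /bern_pgf big_nil !coef1 !mulr0.
case/andP=> /andP[q0 q1] hl ij; rewrite bern_pgf_cons.
have {}IH u v := IH u v hl.
have c0 u : 0 <= (bern_pgf l)`_u by exact: bern_pgf_ge0.
move: (bern_pgf l) c0 IH => f c0 IH.
have a0 : 0 <= 1 - q by rewrite subr_ge0.
case: i ij => [_|i ij].
  rewrite coef_bern_factor_mul0 !coef_bern_factor_mulS.
  have := IH 0 j erefl.
  have := mulr_ge0 (c0 1) (c0 j).
  have := mulr_ge0 (c0 0) (c0 j).
  move: (1 - q) a0 => a a0 h1 h2 h3.
  have := mulr_ge0 (mulr_ge0 a0 q0) h2.
  have := mulr_ge0 (mulr_ge0 q0 q0) h1.
  rewrite -subr_ge0 in h3.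
  have := mulr_ge0 (mulr_ge0 a0 a0) h3.
  nra.
rewrite !coef_bern_factor_mulS.
(* In the terms with factor [q * (1 - q)], the product of the coefficients [i.+1] and [j.+1] occurs
   on both sides and cancels; this inequality remains. It chains two instances of the induction
   hypothesis, or is a single one when [j = i.+1]. *)
have hcross : f`_i * f`_j.+2 <= f`_i.+2 * f`_j.
  move: (ij); rewrite leq_eqVlt => /orP[/eqP <-|ij2].
    by rewrite [leRHS]mulrC; exact: (IH i i.+1).
  case: j ij ij2 => // j ij ij2.
  exact: le_trans (IH i j.+1 (ltnW ij)) (IH i.+1 j ij2).
have haa := IH i.+1 j ij.
have hbb : f`_i * f`_j.+1 <= f`_i.+1 * f`_j by case: j ij {hcross haa} => // j ij; exact: IH.
rewrite -subr_ge0 in haa; rewrite -subr_ge0 in hbb; rewrite -subr_ge0 in hcross.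
move: (1 - q) a0 => a a0.
have := mulr_ge0 (mulr_ge0 a0 q0) hcross.
have := mulr_ge0 (mulr_ge0 q0 q0) hbb.
have := mulr_ge0 (mulr_ge0 a0 a0) haa.
nra.
Qed.

End PGF.

(** * Antichains in the cube under a product measure *)

Section LYM.
Variable R : realFieldType.
Implicit Types (l : seq R) (q : R) (f g : seq bool -> R).

(** Expectation over independent bits with parameters [l]. Plain sequences make conditioning on the
    first bit a computation rule; only strings of length [size l] are evaluated. *)
Fixpoint bern_expect l f : R :=
  if l is q :: l' then
    (1 - q) * bern_expect l' (fun s => f (false :: s)) +
    q * bern_expect l' (fun s => f (true :: s))
  else f [::].

Lemma eq_bern_expect l f g : (forall s, size s = size l -> f s = g s) ->
  bern_expect l f = bern_expect l g.
Proof.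
elim: l f g => [|q l IH] f g fg /=; first exact: fg.
by congr (_ * _ + _ * _); apply: IH => s sl; apply: fg; rewrite /= sl.
Qed.

Lemma ler_bern_expect l f g : all (fun q => 0 <= q <= 1) l ->
  (forall s, size s = size l -> f s <= g s) ->
  bern_expect l f <= bern_expect l g.
Proof.
elim: l f g => [|q l IH] f g /=; first by move=> _; apply.
case/andP=> /andP[q0 q1] hl fg.
by apply: lerD; apply: ler_wpM2l; rewrite ?subr_ge0//;
  apply: IH => // s sl; apply: fg; rewrite /= sl.
Qed.

Lemma bern_expectZ l c f : bern_expect l (fun s => c * f s) = c * bern_expect l f.
Proof. by elim: l f => [//|q l IH] f /=; rewrite !IH; ring. Qed.

Lemma bern_expectD l f g :
  bern_expect l (fun s => f s + g s) = bern_expect l f + bern_expect l g.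
Proof. by elim: l f g => [//|q l IH] f g /=; rewrite !IH; ring. Qed.

Lemma bern_expect_sum l (I : Type) (r : seq I) (F : I -> seq bool -> R) :
  bern_expect l (fun s => \sum_(i <- r) F i s) = \sum_(i <- r) bern_expect l (F i).
Proof.
elim: r => [|i r IH].
  rewrite big_nil -[RHS](mul0r (bern_expect l (fun=> 0))) -bern_expectZ.
  by apply: eq_bern_expect => s _; rewrite big_nil mul0r.
rewrite big_cons -IH -bern_expectD.
by apply: eq_bern_expect => s _; rewrite big_cons.
Qed.

(** On strings of length [n], [all2 implb] is the coordinatewise order of the cube. *)
Definition antichain n (A : pred (seq bool)) := forall s t,
  size s = n -> size t = n -> A s -> A t -> all2 implb s t -> s = t.

Lemma all2_implb_count s t : all2 implb s t -> (count id s <= count id t)%N.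
Proof. by elim: s t => [|[] s IH] [|[] t]//= /IH; lia. Qed.

Lemma all2_implb_count_eq s t :
  all2 implb s t -> (count id t <= count id s)%N -> s = t.
Proof.
elim: s t => [|[] s IH] [|[] t]//= st h.
- by rewrite (IH t st).
- by have := all2_implb_count st; lia.
- by rewrite (IH t st).
Qed.

(* With alpha j = (1 - q) W_j / W'_j, where W and W' are the coefficients of the
   generating functions without and with the coordinate q, log-concavity makes
   alpha nonincreasing from 1 to 0. The weights of the two slices of A are then
   averages, with the weights alpha i - alpha (i + 1), of the weights of the
   antichains "first slice up to rank i, second slice from rank i on". *)
Lemma antichain_LYM l (A : pred (seq bool)) :
  all (fun q => 0 < q < 1) l -> antichain (size l) A ->
  bern_expect l (fun s => (A s)%:R / (bern_pgf l)`_(count id s)) <= 1.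
Proof.
elim: l A => [|q l IH] A.
  move=> _ _ /=; rewrite /bern_pgf big_nil coef1 divr1.
  by case: (A _); rewrite ?ler01.
move=> /[dup] hl' /= /andP[/andP[q0 q1] hl] antiA.
have hlw : all (fun q => 0 <= q <= 1) l.
  by apply: sub_all hl => x /andP[? ?]; rewrite !ltW.
pose n := size l; pose W j := (bern_pgf l)`_j.
pose W' j := (bern_pgf (q :: l))`_j.
have W'0 : W' 0%N = (1 - q) * W 0%N by rewrite /W' bern_pgf_cons coef_bern_factor_mul0.
have W'S j : W' j.+1 = (1 - q) * W j.+1 + q * W j.
  by rewrite /W' bern_pgf_cons coef_bern_factor_mulS.
have Wgt0 j : (j <= n)%N -> 0 < W j by move=> jn; exact: bern_pgf_gt0 hl jn.
have W'gt0 j : (j <= n.+1)%N -> 0 < W' j by move=> jn; exact: bern_pgf_gt0 hl' jn.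
have Wn1 : W n.+1 = 0 by exact: bern_pgf_gt_size.
pose alpha j := (1 - q) * W j / W' j.
have alpha0 : alpha 0%N = 1.
  by rewrite /alpha W'0 divff// mulf_neq0// ?gt_eqF ?subr_gt0 ?Wgt0.
have alphan : alpha n.+1 = 0 by rewrite /alpha Wn1 mulr0 mul0r.
have alpha_le j : (j <= n)%N -> alpha j.+1 <= alpha j.
  move=> jn; rewrite /alpha ler_pdivrMr ?W'gt0// mulrAC ler_pdivlMr ?W'gt0 ?leqW//.
  rewrite -!mulrA ler_pM2l ?subr_gt0// W'S.
  case: j jn => [|j] jn.
    rewrite W'0 mulrC mulrDr -subr_ge0.
    have := mulr_ge0 (ltW q0) (mulr_ge0 (ltW (Wgt0 _ jn)) (ltW (Wgt0 _ jn))).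
    nra.
  have h0 : 0 <= W j.+1 * W j.+1 - W j * W j.+2.
    by rewrite subr_ge0; exact: bern_pgf_log_concave hlw (leqnn j).
  rewrite W'S -subr_ge0; apply: le_trans (mulr_ge0 (ltW q0) h0) _.
  by rewrite le_eqVlt; apply/orP; left; apply/eqP; ring.
have sum_alpha a b : (a <= b)%N ->
    \sum_(a <= i < b) (alpha i - alpha i.+1) = alpha a - alpha b.
  move=> ab; rewrite -opprB -(telescope_sumr alpha ab) -sumrN.
  by apply: eq_bigr => i _; rewrite opprB.
have alphaE j : (j <= n)%N ->
    alpha j = \sum_(0 <= i < n.+1) (alpha i - alpha i.+1) * (j <= i)%N%:R.
  move=> jn; rewrite (@big_cat_nat _ _ _ j)//=; last exact: leqW.
  rewrite [X in _ = X + _]big_nat_cond [X in _ = X + _]big1 ?add0r => [|i]; last first.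
    by rewrite andbT => /andP[_ ij]; rewrite leqNgt ij mulr0.
  rewrite -[LHS]subr0 -{1}alphan -sum_alpha ?leqW//.
  by apply: eq_big_nat => i /andP[-> _]; rewrite mulr1.
have alphaEC j : (j <= n)%N ->
    1 - alpha j.+1 = \sum_(0 <= i < n.+1) (alpha i - alpha i.+1) * (i <= j)%N%:R.
  move=> jn; rewrite (@big_cat_nat _ _ _ j.+1)//=.
  rewrite [X in _ = _ + X]big_nat_cond [X in _ = _ + X]big1 ?addr0 => [|i]; last first.
    by rewrite andbT => /andP[ij _]; rewrite leqNgt ij mulr0.
  rewrite -{1}alpha0 -sum_alpha//.
  by apply: eq_big_nat => i; rewrite ltnS => /andP[_ ->]; rewrite mulr1.
pose A0 := A \o cons false; pose A1 := A \o cons true.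
pose B i : pred (seq bool) := fun s =>
  (A0 s && (count id s <= i)%N) || (A1 s && (i <= count id s)%N).
have A01 s t : size s = n -> size t = n -> A0 s -> A1 t -> ~~ all2 implb s t.
  move=> sn tn As At; apply/negP => st.
  by have := antiA (false :: s) (true :: t); rewrite /= sn tn => /(_ erefl erefl As At st).
(* Only comparisons across the slices are new. A first-slice string below a second-slice one would
   contradict the antichain [A]; in the opposite case the rank bounds around [i] force equal ranks,
   hence equality. *)
have antiB i : antichain n (B i).
  move=> s t sn tn /orP[]/andP[As si] /orP[]/andP[At ti] st.
  - by have := antiA (false :: s) (false :: t); rewrite /= sn tn => /(_ erefl erefl As At st)[].
  - by have := A01 _ _ sn tn As At; rewrite st.
  - by apply: all2_implb_count_eq => //; exact: leq_trans ti si.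
  - by have := antiA (true :: s) (true :: t); rewrite /= sn tn => /(_ erefl erefl As At st)[].
(* The slices are disjoint because [false :: s] lies below [true :: s], so the indicator of the
   union is a sum. *)
have BE i s : size s = n -> ((B i s)%:R : R) =
    (A0 s)%:R * (count id s <= i)%N%:R + (A1 s)%:R * (i <= count id s)%N%:R.
  move=> sn; rewrite /B; have := A01 s s sn sn.
  have -> : all2 implb s s by elim: (s) => //= -[].
  case: (A0 s) => /=; last by case: (A1 s) => _ /=; rewrite ?mul0r ?add0r ?mul1r.
  case: (A1 s) => /= [/(_ isT isT)//|_].
  by rewrite orbF mul1r mul0r addr0.
rewrite -!bern_expectZ -bern_expectD.
rewrite (@eq_bern_expect _ _ (fun s => \sum_(0 <= i < n.+1)
   (alpha i - alpha i.+1) * ((B i s)%:R / W (count id s)))); last first.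
  move=> s sn; have cs : (count id s <= n)%N by rewrite /n -sn count_size.
  rewrite -/(A0 s) -/(A1 s) /= add0n add1n -/(W' _) -/(W' _).
  transitivity ((A0 s)%:R / W (count id s) * alpha (count id s) +
                (A1 s)%:R / W (count id s) * (1 - alpha (count id s).+1)).
    have wn0 := gt_eqF (Wgt0 _ cs); have w'n0 := gt_eqF (W'gt0 _ (leqW cs)).
    have w''n0 : W' (count id s).+1 != 0 by rewrite gt_eqF ?W'gt0.
    (* By the recursion for [W'], the weight of the second slice is the complement of [alpha] one
       rank higher. *)
    have -> : 1 - alpha (count id s).+1 = q * W (count id s) / W' (count id s).+1.
      rewrite /alpha -{1}(divff w''n0) -mulrBl; congr (_ / _).
      by rewrite W'S; ring.
    rewrite /alpha; field.
    by rewrite w''n0 wn0 w'n0.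
  rewrite alphaE// alphaEC// !mulr_sumr -big_split/=; apply: eq_bigr => i _.
  by rewrite BE//; ring.
rewrite bern_expect_sum.
apply: (@le_trans _ _ (\sum_(0 <= i < n.+1) (alpha i - alpha i.+1))); last first.
  by rewrite sum_alpha// alpha0 alphan subr0.
apply: ler_sum_nat => i /andP[_ ilt].
rewrite bern_expectZ -[leRHS]mulr1 ler_wpM2l ?subr_ge0 ?alpha_le//.
exact: IH.
Qed.

(** Dividing by a level measure that is at most [M] shows that the indicator of [A] is at most [M]
    times its LYM weight. *)
Lemma antichain_bern_expect_le l (A : pred (seq bool)) (M : R) :
  all (fun q => 0 < q < 1) l -> antichain (size l) A ->
  (forall j, (j <= size l)%N -> (bern_pgf l)`_j <= M) ->
  bern_expect l (fun s => (A s)%:R) <= M.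
Proof.
move=> hl antiA hM.
have M0 : 0 <= M by apply: le_trans (hM 0%N _); rewrite // ltW// bern_pgf_gt0.
have hlw : all (fun q => 0 <= q <= 1) l.
  by apply: sub_all hl => x /andP[? ?]; rewrite !ltW.
rewrite -[leRHS]mulr1; apply: le_trans (ler_wpM2l M0 (antichain_LYM hl antiA)).
rewrite -bern_expectZ; apply: ler_bern_expect => // s sl.
have cs : (count id s <= size l)%N by rewrite -sl count_size.
rewrite mulrCA -[leLHS]mulr1 ler_wpM2l// ler_pdivlMr ?mul1r ?hM// bern_pgf_gt0//.
Qed.

End LYM.

(** * Hoeffding's extremal principle and Darroch's theorem *)

Section Hoeffding.
Variable R : realFieldType.
Implicit Types (l : seq R) (q : R).

Lemma bern_pgf_perm l1 l2 : perm_eq l1 l2 -> bern_pgf l1 = bern_pgf l2.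
Proof. exact: perm_big. Qed.

Lemma bern_pgf_nseq k q : bern_pgf (nseq k q) = bern_factor q ^+ k.
Proof.
elim: k => [|k IH]; first by rewrite /bern_pgf big_nil expr0.
by rewrite /= bern_pgf_cons IH exprS.
Qed.

Lemma bern_factor0 : bern_factor 0 = 1 :> {poly R}.
Proof. by rewrite /bern_factor subr0 scale0r addr0. Qed.

Lemma bern_factor1 : bern_factor 1 = 'X :> {poly R}.
Proof. by rewrite /bern_factor subrr scale1r add0r. Qed.

Lemma bern_factor_mul a b : bern_factor a * bern_factor b =
  (1 + (a + b) *: ('X - 1)) + (a * b) *: ('X - 1) ^+ 2 :> {poly R}.
Proof.
by rewrite /bern_factor -!mul_polyC !polyCB !polyCD !polyCM !polyC1; ring.
Qed.

(* Moving two parameters with fixed sum changes Phi by a multiple of the change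
   of their product, so either pushing them apart until one reaches 0 or 1, or
   moving them together until one equals the average, does not increase Phi. *)
Lemma hoeffding_extremal (Phi : {poly R} -> R) r l :
  (forall c f g, Phi (f + c *: g) = Phi f + c * Phi g) ->
  all (fun q => 0 <= q <= 1) l ->
  exists r' k theta, [/\ 0 <= theta <= 1,
    r'%:R + k%:R * theta = r%:R + \sum_(q <- l) q,
    Phi ('X^r' * bern_factor theta ^+ k) <= Phi ('X^r * bern_pgf l)
    & (r' + k <= r + size l)%N].
Proof.
move=> lin; have [N] := ubnP (size l); elim: N r l => // N IHN.
(* A parameter 0 contributes the factor 1, and a parameter 1 the factor ['X], which is absorbed into
   the shift [r]. Either way the list gets shorter. *)
have case01 l r : (size l <= N)%N -> all (fun q => 0 <= q <= 1) l ->
    has (fun q => (q == 0) || (q == 1)) l ->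
  exists r' k theta, [/\ 0 <= theta <= 1,
    r'%:R + k%:R * theta = r%:R + \sum_(q <- l) q,
    Phi ('X^r' * bern_factor theta ^+ k) <= Phi ('X^r * bern_pgf l)
    & (r' + k <= r + size l)%N].
  move=> sizel hl /hasP[q ql q01].
  have := perm_to_rem ql; set l1 := seq.rem q l => pl.
  have hl1 : all (fun q => 0 <= q <= 1) l1.
    by move: hl; rewrite (perm_all _ pl) => /andP[].
  have sl : size l = (size l1).+1 by rewrite (perm_size pl).
  have sumE : \sum_(x <- l) x = q + \sum_(x <- l1) x.
    by rewrite (perm_big _ pl) /= big_cons.
  have l1N : (size l1 < N)%N by rewrite -sl.
  rewrite sumE (bern_pgf_perm pl) bern_pgf_cons sl.
  case/orP: q01 => /eqP ->; rewrite ?bern_factor0 ?bern_factor1.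
    rewrite mul1r add0r.
    have [r' [k [th [h1 h2 h3 h4]]]] := IHN r l1 l1N hl1.
    by exists r', k, th; split=> //; rewrite addnS leqW.
  rewrite mulrA -exprSr.
  have [r' [k [th [h1 h2 h3 h4]]]] := IHN r.+1 l1 l1N hl1.
  exists r', k, th; split=> //; last by rewrite addnS.
  by rewrite h2 -natr1; ring.
(* Moving parameters together keeps the length, so an inner induction counts the parameters that
   differ from the average. The average is cleared of its denominator here. *)
move=> r l; have [K] := ubnP (count (fun q => (size l)%:R * q != \sum_(x <- l) x) l).
elim: K r l => // K IHK r l countl; rewrite ltnS => sizel hl.
pose s := \sum_(x <- l) x; pose n : R := (size l)%:R.
have [l0|ln0] := eqVneq (size l) 0%N.
  exists r, 0%N, 0; rewrite (size0nil l0) big_nil mulr0 /bern_pgf big_nil expr0.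
  by split=> //; rewrite ?lexx ?ler01.
have n0 : 0 < n by rewrite ltr0n lt0n.
have [|no01] := boolP (has (fun q => (q == 0) || (q == 1)) l).
  exact: case01.
have [/allP alls|/allPn[a0 a0l a0s]] := boolP (all (fun q => n * q == s) l).
  have lE : l = nseq (size l) (s / n).
    apply/all_pred1P/allP => x xl /=.
    have /eqP <- := alls x xl; apply/eqP; rewrite [n * x]mulrC mulfK ?gt_eqF//.
  exists r, (size l), (s / n); split=> //.
  - have /hasP[x xl _] : has predT l by rewrite has_predT lt0n.
    rewrite -(eqP (alls x xl)) [n * x]mulrC mulfK ?gt_eqF//.
    exact: (allP hl).
  - by rewrite -/n mulrCA divff ?gt_eqF// mulr1.
  - by rewrite [in leRHS]lE bern_pgf_nseq.
have sum0 : \sum_(q <- l) (n * q - s) = 0.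
  by rewrite sumrB -mulr_sumr big_const_seq count_predT iter_addr_0 mulr_natl subrr.
(* The deviations from the average sum to zero and are not all zero, so both signs occur: [c = 1]
   yields some [a] below the average, [c = -1] some [b] above it. *)
have sign_change (c : R) : c != 0 -> exists2 q, q \in l & c * (n * q - s) < 0.
  move=> c0; apply/hasP; apply: contraNT a0s => /hasPn h.
  have /eqP : \sum_(q <- l) c * (n * q - s) = 0 by rewrite -mulr_sumr sum0 mulr0.
  rewrite big_seq psumr_eq0 => [|q ql]; last by rewrite leNgt h.
  move=> /allP/(_ _ a0l); rewrite a0l/= mulf_eq0 (negbTE c0)/= subr_eq0.
  by [].
have [a al] := sign_change 1 (oner_neq0 _); rewrite mul1r subr_lt0 => as_.
have [b bl] := sign_change (-1) (@ltr0_neq0 _ _ (ltrN10 _)).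
rewrite mulN1r oppr_lt0 subr_gt0 => sb.
have ab : a < b by rewrite -(ltr_pM2l n0); exact: lt_trans as_ sb.
have pl0 := perm_to_rem al.
have bl' : b \in seq.rem a l.
  have : b \in a :: seq.rem a l by rewrite -(perm_mem pl0).
  by rewrite inE gt_eqF.
set l' := seq.rem b (seq.rem a l).
have pl : perm_eq l [:: a, b & l'].
  by apply: (perm_trans pl0); rewrite perm_cons perm_to_rem.
have open01 x : x \in l -> 0 < x < 1.
  move=> xl; have /andP[x0 x1] := allP hl _ xl.
  have := hasPn no01 _ xl; rewrite negb_or => /andP[xn0 xn1].
  by rewrite !lt_neqAle x0 x1 xn1 eq_sym xn0.
have hl' : all (fun q => 0 <= q <= 1) l'.
  by move: hl; rewrite (perm_all _ pl) /= => /and3P[].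
have sl : size l = (size l').+2 by rewrite (perm_size pl).
have sumE : \sum_(q <- l) q = a + b + \sum_(q <- l') q.
  by rewrite (perm_big _ pl) /= !big_cons addrA.
(* For a fixed sum, the product of two factors depends on the product of their parameters only
   through its [('X - 1) ^+ 2] term; [Delta] is the slope of [Phi] in that product. *)
pose Delta := Phi ('X^r * (('X - 1) ^+ 2 * bern_pgf l')).
have PhiE c d : c + d = a + b ->
    Phi ('X^r * bern_pgf [:: c, d & l']) =
    Phi ('X^r * bern_pgf l) + (c * d - a * b) * Delta.
  move=> cd; rewrite /Delta -lin; congr Phi.
  rewrite (bern_pgf_perm pl) !bern_pgf_cons ![_ * (_ * bern_pgf l')]mulrA.
  by rewrite !bern_factor_mul cd -!mul_polyC polyCB; ring.
have step c d : c + d = a + b -> 0 <= c <= 1 -> 0 <= d <= 1 ->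
   (c * d - a * b) * Delta <= 0 ->
   (exists r' k theta, [/\ 0 <= theta <= 1,
    r'%:R + k%:R * theta = r%:R + \sum_(q <- [:: c, d & l']) q,
    Phi ('X^r' * bern_factor theta ^+ k) <= Phi ('X^r * bern_pgf [:: c, d & l'])
    & (r' + k <= r + size [:: c, d & l'])%N]) ->
   (exists r' k theta, [/\ 0 <= theta <= 1,
    r'%:R + k%:R * theta = r%:R + \sum_(q <- l) q,
    Phi ('X^r' * bern_factor theta ^+ k) <= Phi ('X^r * bern_pgf l)
    & (r' + k <= r + size l)%N]).
  move=> cd c01 d01 hD [r' [k [th [h1 h2 h3 h4]]]]; exists r', k, th; split=> //.
  - by rewrite h2 sumE !big_cons [c + _]addrA cd.
  - by apply: le_trans h3 _; rewrite PhiE// gerDl.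
  - by rewrite sl.
pose m := s / n.
have am : a < m by rewrite ltr_pdivlMr// mulrC.
have mb : m < b by rewrite ltr_pdivrMr// mulrC.
have /andP[apos a1] := open01 a al; have /andP[bpos b1] := open01 b bl.
(* If [Delta] is nonnegative the product of the pair is lowered, to [(0, a + b)] or
   [(1, a + b - 1)]; otherwise it is raised, to [(m, a + b - m)] with [m] the average. *)
have [Dge0|Dlt0] := leP 0 Delta.
  have [ab1|ab1] := leP (a + b) 1.
    apply: (step 0 (a + b)); rewrite ?add0r ?lexx ?ler01 ?ab1 ?addr_ge0 ?(ltW apos) ?(ltW bpos)//.
      by have := mulr_ge0 (mulr_ge0 (ltW apos) (ltW bpos)) Dge0; lra.
    apply: case01; rewrite /= -?sl ?eqxx//.
    by rewrite lexx ler01 ab1 addr_ge0 ?ltW.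
  have ab2 : 0 <= a + b - 1 <= 1 by lra.
  apply: (step 1 (a + b - 1)); rewrite ?lexx ?ler01//.
  - by ring.
  - by rewrite mulr_le0_ge0// mul1r; nra.
  - by apply: case01; rewrite /= -?sl ?eqxx ?orbT// lexx ler01 ab2.
have m01 : 0 <= m <= 1 by lra.
have d01 : 0 <= a + b - m <= 1 by lra.
apply: (step m (a + b - m)) => //.
- by ring.
- by rewrite mulr_ge0_le0 ?ltW//; nra.
apply: IHK; rewrite /= -?sl ?m01 ?d01//.
rewrite !big_cons addrA.
have -> : m + (a + b - m) + \sum_(x <- l') x = s by rewrite /s sumE; ring.
have nm : n * m = s by rewrite /m mulrCA divff ?gt_eqF// mulr1.
rewrite -/n nm eqxx /=.
(* Both [a] and [b] were counted as off average, while at most [a + b - m] is counted now. *)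
move: countl; rewrite -/s -/n (permP pl) /= (lt_eqF as_) (gt_eqF sb) /=.
set u := count _ _; set v := nat_of_bool _; have : (v <= 1)%N by rewrite /v; case: (_ == _).
rewrite add0n !add1n => v1; rewrite ltnS; apply: leq_trans.
by rewrite ltnS -[u.+1]add1n leq_add2r.
Qed.
End Hoeffding.

(** * Monotonicity of the Poisson binomial law on either side of its mean *)

Section Darroch.
Variable R : realFieldType.
Implicit Types (l : seq R) (q : R).

Lemma coef_bern_factor_exp q k t :
  (bern_factor q ^+ k)`_t = q ^+ t * (1 - q) ^+ (k - t) *+ 'C(k, t).
Proof.
rewrite exprDn coef_sum.
have coefE (i : 'I_k.+1) : ((1 - q)%:P ^+ (k - i) * (q *: 'X) ^+ i *+ 'C(k, i))`_t =
    if t == i then q ^+ i * (1 - q) ^+ (k - i) *+ 'C(k, i) else 0.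
  rewrite coefMn -polyC_exp coefCM exprZn coefZ coefXn.
  by case: eqP => _; rewrite ?mulr1 ?mulr0 ?mul0rn// mulrC.
rewrite (eq_bigr _ (fun i _ => coefE i)) -big_mkcond/=.
have [tk|kt] := ltnP t k.+1; last first.
  rewrite bin_small// mulr0n big_pred0// => i.
  by apply/negbTE/eqP => ti; move: kt; rewrite ti leqNgt ltn_ord.
by rewrite (big_pred1 (Ordinal tk)).
Qed.

(** The ratio of consecutive binomial probabilities, cross-multiplied so that it also covers [q = 1]
    and [k <= t]. *)
Lemma bern_factor_exp_ratio q k t :
  (bern_factor q ^+ k)`_t.+1 * (1 - q) * t.+1%:R =
  (bern_factor q ^+ k)`_t * q * (k - t)%:R.
Proof.
rewrite !coef_bern_factor_exp.
have [kt|tk] := leqP k t; first by rewrite bin_small// (eqP kt) mulr0n !mul0r mulr0.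
have -> : (k - t = (k - t.+1).+1)%N by lia.
have h : ((t.+1)%:R * 'C(k, t.+1)%:R : R) = (k - t.+1).+1%:R * 'C(k, t)%:R.
  by rewrite -!natrM mul_bin_left; congr (_%:R); congr (_ * _)%N; lia.
rewrite -[_ *+ 'C(k, t.+1)]mulr_natr -[_ *+ 'C(k, t)]mulr_natr.
transitivity (q ^+ t.+1 * (1 - q) ^+ (k - t.+1).+1 * (t.+1%:R * 'C(k, t.+1)%:R)).
  by rewrite [(1 - q) ^+ _.+1]exprSr; move: (q ^+ _) ((1-q) ^+ _) (_%:R) (_%:R) => *; ring.
by rewrite h [q ^+ _.+1]exprSr; move: (q ^+ _) ((1-q) ^+ _) (_%:R) (_%:R) => *; ring.
Qed.

Lemma bern_factor_exp_ge0 q k t : 0 <= q <= 1 -> 0 <= (bern_factor q ^+ k)`_t.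
Proof.
case/andP=> q0 q1; rewrite coef_bern_factor_exp mulrn_wge0// mulr_ge0// exprn_ge0//.
by rewrite subr_ge0.
Qed.

Lemma bern_factor_exp_decr q k t : 0 <= q <= 1 -> k%:R * q <= t%:R ->
  (bern_factor q ^+ k)`_t.+1 <= (bern_factor q ^+ k)`_t.
Proof.
move=> q01 kqt; have f0 := bern_factor_exp_ge0 k _ q01.
have [kt|tk] := leqP k t.
  by rewrite [leLHS]coef_bern_factor_exp bin_small// mulr0n f0.
case/andP: (q01) => q0; rewrite le_eqVlt => /orP[/eqP q1|q1].
  by move: kqt; rewrite q1 mulr1 ler_nat leqNgt tk.
have h : 0 < (1 - q) * t.+1%:R by rewrite mulr_gt0 ?subr_gt0 ?ltr0n.
rewrite -(ler_pM2r h) mulrA bern_factor_exp_ratio -mulrA ler_wpM2l//.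
by rewrite natrB ?(ltnW tk)// -natr1; nra.
Qed.

Lemma bern_factor_exp_incr q k t : 0 <= q <= 1 -> t.+1%:R <= k%:R * q ->
  (bern_factor q ^+ k)`_t <= (bern_factor q ^+ k)`_t.+1.
Proof.
move=> q01 kqt; have f0 := bern_factor_exp_ge0 k _ q01.
case/andP: (q01) => q0 q1.
have tk : (t < k)%N.
  by rewrite -(ler_nat R); apply: le_trans kqt _; rewrite ler_piMr.
have h : 0 < q * (k - t)%:R.
  rewrite mulr_gt0 ?ltr0n ?subn_gt0// lt_neqAle q0 andbT eq_sym.
  by apply: contraTneq kqt => ->; rewrite mulr0 -ltNge ltr0n.
rewrite -(ler_pM2r h) mulrA -bern_factor_exp_ratio -mulrA ler_wpM2l//.
by rewrite natrB ?(ltnW tk)// -natr1 in kqt *; nra.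
Qed.

(** The difference of two neighbouring coefficients is a linear functional, so Hoeffding's principle
    reduces its sign to that for a binomial law shifted by [r], of the same mean. The shift is at
    most the mean, hence at most [j]. *)
Lemma bern_pgf_decr l j : all (fun q => 0 <= q <= 1) l ->
  \sum_(q <- l) q <= j%:R -> (bern_pgf l)`_j.+1 <= (bern_pgf l)`_j.
Proof.
move=> hl hj; pose Phi (f : {poly R}) := f`_j - f`_j.+1.
have lin c f g : Phi (f + c *: g) = Phi f + c * Phi g.
  by rewrite /Phi !coefD !coefZ; ring.
have [r [k [q [q01]]]] := hoeffding_extremal 0%N lin hl.
rewrite mulr0n add0r /Phi expr0 mul1r => mean => h _; rewrite -subr_ge0; apply: le_trans h.
rewrite subr_ge0 !coefXnM.
have rj : (r <= j)%N.
  rewrite -(ler_nat R); apply: le_trans hj; rewrite -mean lerDl.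
  by case/andP: q01 => q0 _; rewrite mulr_ge0.
rewrite ltnNge leqW// ltnNge rj /= subSn//.
by apply: bern_factor_exp_decr => //; rewrite natrB// lerBrDl mean.
Qed.

Lemma bern_pgf_incr l j : all (fun q => 0 <= q <= 1) l ->
  j.+1%:R <= \sum_(q <- l) q -> (bern_pgf l)`_j <= (bern_pgf l)`_j.+1.
Proof.
move=> hl hj; pose Phi (f : {poly R}) := f`_j.+1 - f`_j.
have lin c f g : Phi (f + c *: g) = Phi f + c * Phi g.
  by rewrite /Phi !coefD !coefZ; ring.
have [r [k [q [q01]]]] := hoeffding_extremal 0%N lin hl.
rewrite mulr0n add0r /Phi expr0 mul1r => mean => h _; rewrite -subr_ge0; apply: le_trans h.
rewrite subr_ge0 !coefXnM.
(* Below the shift the coefficient [j] vanishes, and the difference is trivially nonnegative. *)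
have [jr|rj] := ltnP j r.
  by case: ifP => // _; rewrite bern_factor_exp_ge0.
rewrite ltnNge leqW//= subSn//.
apply: bern_factor_exp_incr => //.
by rewrite -subSn// natrB ?leqW// lerBlDl mean.
Qed.

End Darroch.

(** The coefficients increase up to the floor of the mean and decrease from its ceiling on. No
    integer lies strictly between the two, so the larger of these two coefficients is the
    maximum. *)
Lemma bern_pgf_mode (R : archiRealFieldType) (l : seq R) :
  all (fun q => 0 <= q <= 1) l ->
  let mu := \sum_(q <- l) q in
  exists2 m : nat, m%:Z = Num.floor mu \/ m%:Z = Num.ceil mu &
    forall j, (bern_pgf l)`_j <= (bern_pgf l)`_m.
Proof.
move=> hl mu.
have mu0 : 0 <= mu.
  by rewrite /mu big_seq sumr_ge0// => q /(allP hl)/andP[].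
have [a aE] : exists a : nat, a%:Z = Num.floor mu.
  by exists `|Num.floor mu|%N; rewrite gez0_abs// floor_ge0.
have [b bE] : exists b : nat, b%:Z = Num.ceil mu.
  by exists `|Num.ceil mu|%N; rewrite gez0_abs// ceil_ge0// (lt_le_trans _ mu0)// ltrN10.
have amu : a%:R <= mu by rewrite -[a%:R]/(a%:Z%:~R) -floor_ge_int aE.
have mub : mu <= b%:R by rewrite -[b%:R]/(b%:Z%:~R) -ceil_le_int bE.
have low j : (j <= a)%N -> (bern_pgf l)`_j <= (bern_pgf l)`_a.
  elim: a {aE} amu => [|a IH] amu; first by rewrite leqn0 => /eqP->.
  rewrite leq_eqVlt => /orP[/eqP->//|ja]; apply: le_trans (IH _ ja) _.
    by apply: le_trans amu; rewrite ler_nat.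
  exact: bern_pgf_incr.
have high j : (b <= j)%N -> (bern_pgf l)`_j <= (bern_pgf l)`_b.
  elim: j => [|j IH]; first by rewrite leqn0 => /eqP->.
  rewrite leq_eqVlt => /orP[/eqP->//|bj]; apply: le_trans (IH bj).
  by apply: bern_pgf_decr => //; apply: le_trans mub _; rewrite ler_nat.
have low_or_high j : (j <= a)%N || (b <= j)%N.
  rewrite -!lez_nat aE bE.
  by rewrite floor_ge_int ceil_le_int le_total.
have [ab|ba] := leP (bern_pgf l)`_a (bern_pgf l)`_b.
  exists b; [by right|] => j; case/orP: (low_or_high j) => [/low h|/high//].
  exact: le_trans h ab.
exists a; [by left|] => j; case/orP: (low_or_high j) => [/low//|/high h].
exact: le_trans h (ltW ba).
Qed.

(** * From random variables to sums over the cube *)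

Lemma sum_tuple_cons (V : nmodType) n (F : n.+1.-tuple bool -> V) :
  \sum_(t : n.+1.-tuple bool) F t =
  \sum_(t : n.-tuple bool) F (cons_tuple false t) +
  \sum_(t : n.-tuple bool) F (cons_tuple true t).
Proof.
rewrite (reindex (fun bt : bool * n.-tuple bool => cons_tuple bt.1 bt.2)) /=.
  rewrite -(pair_big xpredT xpredT (fun b (t : n.-tuple bool) => F (cons_tuple b t))) /=.
  by rewrite big_bool addrC.
exists (fun t => (thead t, behead_tuple t)) => [[b t] _|t _] /=.
  by congr pair; apply: val_inj.
by rewrite [RHS]tuple_eta; apply: val_inj.
Qed.

Lemma bern_expect_tupleE (R : realFieldType) n (q : 'I_n -> R) (f : seq bool -> R) :
  bern_expect [seq q i | i <- enum 'I_n] f =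
  \sum_(t : n.-tuple bool) f t * \prod_i (if tnth t i then q i else 1 - q i).
Proof.
elim: n q f => [|n IH] q f.
  rewrite enum_ord0 /= (big_pred1 [tuple]) => [|t]; last by apply/esym/eqP; exact: tuple0.
  by rewrite big_ord0 mulr1.
rewrite enum_ordSl /= -map_comp sum_tuple_cons !IH !mulr_sumr.
by congr (_ + _); apply: eq_bigr => t _; rewrite big_ord_recl tnth0 mulrCA;
  congr (_ * (_ * _)); apply: eq_bigr => i _; rewrite tnthS.
Qed.

Lemma content_bigsetU_le d (T : ringOfSetsType d) (R : realFieldType)
    (mu : {content set T -> \bar R}) (I : Type) (s : seq I) (F : I -> set T) :
  (forall i, measurable (F i)) ->
  (mu (\big[setU/set0]_(i <- s) F i) <= \sum_(i <- s) mu (F i))%E.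
Proof.
move=> mF; elim: s => [|i s IH]; first by rewrite !big_nil measure0.
rewrite !big_cons; apply: le_trans (measureU2 _ _ _) _ => //.
  exact: bigsetU_measurable.
exact: leeD2l.
Qed.

Section TwoValued.
Variables (R : realType) (d : measure_display) (T : measurableType d).
Variables (P : probability T R) (n : nat) (X : 'I_n -> {RV P >-> R}).
Variables (v : 'I_n -> bool -> R) (q : 'I_n -> R).
Hypothesis indepX : mutually_independent X.
Hypothesis vI : forall i, v i true != v i false.
Hypothesis lawX : forall i b,
  P (X i @^-1` [set v i b]) = (if b then q i else 1 - q i)%:E.

Let cell (t : n.-tuple bool) := \bigcap_(i in [set: 'I_n]) (X i @^-1` [set v i (tnth t i)]).
Let other (i : 'I_n) := ~` (X i @^-1` [set v i true] `|` X i @^-1` [set v i false]).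

Let mpre i b : measurable (X i @^-1` [set v i b]).
Proof. exact: measurable_funPTI. Qed.

Let mcell t : measurable (cell t).
Proof. by apply: fin_bigcap_measurable => // i _; exact: mpre. Qed.

Let mother i : measurable (other i).
Proof. by apply: measurableC; apply: measurableU; exact: mpre. Qed.

Let P_cell t : P (cell t) = (\prod_i (if tnth t i then q i else 1 - q i))%:E.
Proof.
have := indepX (J := finset.setT) (A := fun i => [set v i (tnth t i)])
  (fun i _ => measurable_set1 _).
rewrite (_ : [set` _] = setT); last by apply/seteqP; split => i //= _; rewrite inE.
move=> ->; rewrite -prodEFin; apply: eq_big => [i|i _]; first by rewrite inE.
exact: lawX.
Qed.

Let P_other i : P (other i) = 0%E.
Proof.
rewrite probability_setC; last by apply: measurableU; exact: mpre.
have -> : P (X i @^-1` [set v i true] `|` X i @^-1` [set v i false]) =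
    (P (X i @^-1` [set v i true]) + P (X i @^-1` [set v i false]))%E.
  apply: measureU; [exact: mpre|exact: mpre|].
  by apply/seteqP; split => // w /= [-> /eqP]; exact/negP/vI.
have -> := lawX i true; have -> := lawX i false.
by rewrite -EFinD [(q i + _)%R]addrC subrK subrr.
Qed.

(** The event is covered by the cells of the bit strings in [A] together with the null sets where
    some [X i] takes neither value; finite subadditivity then gives the bound. *)
Lemma prob_le_bern_expect (E : set T) (A : pred (seq bool)) : measurable E ->
  (forall w (t : n.-tuple bool), E w -> (forall i, X i w = v i (tnth t i)) -> A t) ->
  (P E <= (bern_expect [seq q i | i <- enum 'I_n] (fun s => (A s)%:R))%:E)%E.
Proof.
move=> mE EA.
pose U1 := \big[setU/set0]_(t <- seq.filter (fun t : n.-tuple bool => A t)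
  (enum {: n.-tuple bool})) cell t.
pose U2 := \big[setU/set0]_(i <- enum 'I_n) other i.
have sub : E `<=` U1 `|` U2.
  move=> w Ew; rewrite /U1 /U2 -!bigcup_seq.
  have [[i wi]|noth] := pselect (exists i, other i w).
    by right; exists i => //=; rewrite mem_enum.
  have Xw i : exists b, X i w = v i b.
    apply: contrapT => h; apply: noth; exists i => -[] Xi; apply: h.
      by exists true.
    by exists false.
  pose t := [tuple sval (cid (Xw i)) | i < n].
  have Xt i : X i w = v i (tnth t i) by rewrite tnth_mktuple; case: (cid (Xw i)).
  by left; exists t; [rewrite /= mem_filter mem_enum (EA w t)|move=> i _; exact: Xt].
apply: (@le_trans _ _ (P (U1 `|` U2))).
  by apply: le_measure; rewrite ?inE//; apply: measurableU; apply: bigsetU_measurable.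
apply: le_trans (measureU2 _ _ _) _.
- exact: bigsetU_measurable.
- exact: bigsetU_measurable.
rewrite -[leRHS]adde0; apply: leeD; last first.
  apply: le_trans (content_bigsetU_le _ _ _) _ => //.
  by rewrite big1// => i _; exact: P_other.
apply: le_trans (content_bigsetU_le _ _ _) _ => //.
rewrite bern_expect_tupleE big_filter big_enum_cond/= -sumEFin big_mkcond/=.
rewrite lee_sum// => t _; rewrite P_cell; case: (A t); rewrite ?mul1r ?mul0r//.
Qed.

End TwoValued.

(** * Reduction of the vector equation to an antichain *)

(** Each vector is read as a polynomial, and the functional is evaluation at [z]. The product of
    these nonzero polynomials cannot vanish at as many naturals as its size, which exceeds its
    degree. *)
Lemma exists_separating_functional (R : numFieldType) d (I : finType)
    (a : I -> 'rV[R]_d) : (forall i, a i != 0) ->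
  exists z : R, forall i, (rVpoly (a i)).[z] != 0.
Proof.
move=> an0; pose g := \prod_i rVpoly (a i).
have gn0 : g != 0.
  apply/prodf_neq0 => i _; apply: contra_neq (an0 i) => h.
  by rewrite -[a i]rVpolyK h linear0.
have [|/allPn[z _ zg]] := boolP (all (root g) [seq m%:R | m <- iota 0 (size g)]).
  move=> h; have := max_poly_roots gn0 h; rewrite map_inj_uniq ?iota_uniq; last first.
    by move=> i j /eqP; rewrite eqr_nat => /eqP.
  by rewrite size_map size_iota ltnn => /(_ isT).
exists z => i; apply: contra zg => /eqP zi.
by rewrite /root horner_prod (bigD1 i)//= zi mul0r.
Qed.

(** For comparable [s] and [t] on the level set, the weighted differences are nonnegative and sum to
    zero, so each vanishes. *)
Lemma antichain_level_set (R : realDomainType) n (b : 'I_n -> R) (c : R) :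
  (forall i, 0 < b i) ->
  antichain n (fun s => \sum_i b i * (nth false s i)%:R == c).
Proof.
move=> b0 s t sn tn /eqP sc /eqP tc st.
have le_st i : ((nth false s i)%:R <= (nth false t i)%:R :> R).
  rewrite ler_nat; elim: (s) (t) st i => [|x s' IH] [|y t']//= /andP[xy st'] [|i] /=.
    by move: x y xy => [] [].
  exact: IH.
have d0 i : 0 <= b i * ((nth false t i)%:R - (nth false s i)%:R).
  by rewrite mulr_ge0 ?subr_ge0// ltW.
have : \sum_i b i * ((nth false t i)%:R - (nth false s i)%:R) == 0.
  by under eq_bigr do rewrite mulrBr; rewrite sumrB sc tc subrr.
rewrite psumr_eq0// => /allP h.
apply: (@eq_from_nth _ false); first by rewrite sn tn.
move=> i; rewrite sn => ilt; have := h (Ordinal ilt); rewrite mem_index_enum => /(_ isT).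
rewrite /= mulf_eq0 gt_eqF//= subr_eq0 eqr_nat.
by case: (nth _ t i); case: (nth _ s i).
Qed.

(** * Parameters p and 1 - p, and differences of binomials *)

Lemma bern_pgf_two_valued (R : realFieldType) n (neg : pred 'I_n) (p : R) :
  bern_pgf [seq (if neg i then 1 - p else p) | i <- enum 'I_n] =
  bern_factor (1 - p) ^+ #|neg| * bern_factor p ^+ (n - #|neg|).
Proof.
rewrite /bern_pgf big_map big_enum/= (bigID neg)/=; congr (_ * _).
  by rewrite (eq_bigr (fun=> bern_factor (1 - p))) ?prodr_const// => i ->.
rewrite (eq_bigr (fun=> bern_factor p)) => [|i /negbTE->//].
rewrite prodr_const; congr (_ ^+ _).
by have := cardC neg; rewrite card_ord => /(canRL (addKn _)) <-.
Qed.

(** The mean is put in the form [mu_k + k], so that its floor and ceiling are those of [mu_k]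
    shifted by the integer [k]. *)
Lemma sum_two_valued (R : realFieldType) n (neg : pred 'I_n) (p : R) :
  \sum_(q <- [seq (if neg i then 1 - p else p) | i <- enum 'I_n]) q =
  (n%:R - 2 * #|neg|%:R) * p + #|neg|%:R.
Proof.
rewrite big_map big_enum/= (bigID neg)/=.
rewrite (eq_bigr (fun=> 1 - p)) ?sumr_const => [|i ->//].
rewrite [X in _ + X](eq_bigr (fun=> p)) ?sumr_const => [|i /negbTE->//].
rewrite -[_ *+ #|neg|]mulr_natr -[p *+ _]mulr_natr.
have -> : #|predC neg| = (n - #|neg|)%N.
  by have := cardC neg; rewrite card_ord => /(canRL (addKn _)) <-.
by rewrite natrB; [ring|rewrite -[leqRHS](card_ord n); exact: max_card].
Qed.

Lemma binomial_RV_preimage1 d (T : measurableType d) (R : realType)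
    (Q : probability T R) (B : {RV Q >-> nat}) m (p : R) i :
  0 <= p <= 1 -> binomial_RV B m p ->
  Q (B @^-1` [set i]) = ((bern_factor p ^+ m)`_i)%:E.
Proof.
move=> p01 /(congr1 (fun mu => mu [set i])).
rewrite /distribution /pushforward => ->.
rewrite /binomial_prob p01 esum_set1; last by rewrite lee_fin binomial_pmf_ge0.
by rewrite coef_bern_factor_exp.
Qed.

Lemma coef_rev_bern_factor_exp (R : realFieldType) (p : R) k i : (i <= k)%N ->
  (bern_factor (1 - p) ^+ k)`_i = (bern_factor p ^+ k)`_(k - i).
Proof.
by move=> ik; rewrite !coef_bern_factor_exp bin_sub// subKn// subKr mulrC.
Qed.

(** If [B'] is binomial with parameters [k] and [p], then [k - B'] is binomial with parameters [k]
    and [1 - p]; the product is thus the generating function of [B - B' + k]. *)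
Lemma coef_le_binomial_difference d (T : measurableType d) (R : realType)
    (Q : probability T R) (B B' : {RV Q >-> nat}) m k (p : R) j :
  0 <= p <= 1 -> binomial_RV B m p -> binomial_RV B' k p -> independent2 B B' ->
  (((bern_factor (1 - p) ^+ k * bern_factor p ^+ m)`_j)%:E <=
   Q [set w | ((B w)%:Z - (B' w)%:Z = j%:Z - k%:Z)%R])%E.
Proof.
move=> p01 hB hB' indep.
pose G := [set w | ((B w)%:Z - (B' w)%:Z = j%:Z - k%:Z)%R].
have mpre (C : {RV Q >-> nat}) (A : set nat) : measurable (C @^-1` A).
  exact: measurable_funPTI.
have mG : measurable G.
  rewrite (_ : G = \bigcup_i (B' @^-1` [set i] `&`
      B @^-1` [set b | (b%:Z - i%:Z = j%:Z - k%:Z)%R])).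
    by apply: bigcup_measurable => i _; apply: measurableI; exact: mpre.
  apply/seteqP; split => w /=; first by move=> Gw; exists (B' w).
  by case=> i _ [/= <-].
(* Here [i] is the value of [k - B']. These disjoint cells lie in the event and match the terms of
   the convolution; for [i > k] the term is zero. *)
pose F (i : 'I_j.+1) := if (i <= k)%N then
  B @^-1` [set (j - i)%N] `&` B' @^-1` [set (k - i)%N] else set0.
have mF i : measurable (F i).
  by rewrite /F; case: ifP => // _; apply: measurableI; exact: mpre.
have tF : trivIset setT F.
  move=> i i' _ _ [w []]; rewrite /F; case: ifP => // ik [_ /= Bi]; case: ifP => // ik' [_ /= Bi'].
  by apply: val_inj => /=; lia.
have mUF : measurable (\big[setU/set0]_(i < j.+1) F i) by exact: bigsetU_measurable.
apply: (@le_trans _ _ (Q (\big[setU/set0]_(i < j.+1) F i))); last first.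
  apply: le_measure; rewrite ?inE//.
  rewrite -bigcup_seq => w [i _]; rewrite /F; case: ifP => // ik [/= -> ->].
  by have := ltn_ord i; rewrite ltnS => ij; rewrite -!subzn//; ring.
have -> : Q (\big[setU/set0]_(i < j.+1) F i) = (\sum_(i < j.+1) Q (F i))%E.
  exact: measure_semi_additive_ord.
rewrite coefM -sumEFin.
apply: lee_sum => i _; rewrite /F; case: ifP => ik; last first.
  by rewrite measure0 coef_bern_factor_exp bin_small ?mulr0n ?mul0r// ltnNge ik.
rewrite indep// coef_rev_bern_factor_exp// mulrC EFinM.
by rewrite !(binomial_RV_preimage1 _ p01 hB) (binomial_RV_preimage1 _ p01 hB').
Qed.

Theorem lemma6 (R : realType) (d : nat) (p : R) :
  (0 < d)%N -> 0 < p <= 1 / 2 ->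
  exists n0 : nat, forall n : nat, (n0 <= n)%N ->
  forall (disp : measure_display) (T : measurableType disp)
    (P : probability T R) (X : 'I_n -> {RV P >-> R})
    (a : 'I_n -> 'rV[R]_d) (x : 'rV[R]_d)
    (disp' : measure_display) (T' : measurableType disp')
    (Q : probability T' R) (B B' : 'I_n.+1 -> {RV Q >-> nat}),
  (forall i, bernoulli_RV (X i) p) ->
  mutually_independent X ->
  (forall i, a i != 0) ->
  (forall k : 'I_n.+1, binomial_RV (B k) (n - k)%N p) ->
  (forall k : 'I_n.+1, binomial_RV (B' k) k p) ->
  (forall k : 'I_n.+1, independent2 (B k) (B' k)) ->
  let mu (k : 'I_n.+1) : R := (n%:R - 2 * k%:R) * p in
  (P [set w | (\sum_(i < n) X i w *: a i = x)%R] <=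
   \big[maxe/-oo]_(k < n.+1)
     \big[maxe/-oo]_(x' <- [:: Num.floor (mu k); Num.ceil (mu k)])
       Q [set w | ((B k w)%:Z - (B' k w)%:Z = x')%R])%E.
Proof.
move=> _ /andP[p0 p12]; exists 0%N => n _ disp T P X a x disp' T' Q B B'.
move=> bernX indepX an0 binB binB' indepB; cbv zeta.
have p1 : p < 1 by lra.
have p01 : 0 <= p <= 1 by rewrite !ltW.
have [z zn0] := exists_separating_functional an0.
pose b i := (rVpoly (a i)).[z].
pose neg : pred 'I_n := fun i => b i < 0.
pose q i := if neg i then 1 - p else p.
pose l := [seq q i | i <- enum 'I_n].
(* The bit [e] stands for [X i], or for [1 - X i] when [b i] is negative; [q i] is the probability
   that it is 1. *)
pose v i (e : bool) : R := (e (+) neg i)%:R.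
have ql : all (fun q => 0 < q < 1) l.
  by apply/allP => _ /mapP[i _ ->]; rewrite /q; case: ifP => _; lra.
have qlw : all (fun q => 0 <= q <= 1) l.
  by apply: sub_all ql => y /andP[? ?]; rewrite !ltW.
have sl : size l = n by rewrite size_map size_enum_ord.
have negn : (#|neg| < n.+1)%N by rewrite ltnS -[leqRHS](card_ord n) max_card.
(* The number of flipped coordinates is the index at which the outer maximum is used. *)
pose k := Ordinal negn.
have lawX i e : P (X i @^-1` [set v i e]) = (if e then q i else 1 - q i)%:E.
  have [hX1 hX0] := bernX i; rewrite /v /q.
  by case: e; case: (neg i) => /=; rewrite ?subKr.
have vI i : v i true != v i false.
  by rewrite /v; case: (neg i); rewrite /= ?oner_eq0// eq_sym oner_eq0.
pose E := [set w | (\sum_(i < n) X i w *: a i = x)%R].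
have mE : measurable E.
  rewrite (_ : E = \bigcap_(j in [set: 'I_d])
      ((fun w => \sum_(i < n) X i w * a i 0 j) @^-1` [set x 0 j])).
    apply: fin_bigcap_measurable => // j _.
    rewrite -[X in measurable X]setTI.
    apply: measurable_sum => // i; exact: measurable_realfun.measurable_funM.
  apply/seteqP; split => w /=.
    by move=> <- j _ /=; rewrite summxE; apply: eq_bigr => i _; rewrite mxE.
  move=> h; apply/rowP => j; rewrite -(h j I) summxE.
  by apply: eq_bigr => i _; rewrite mxE.
(* A flipped coordinate satisfies [b i * X i = b i + |b i| * e]; its constant part moves to the
   right-hand side. *)
pose c := (rVpoly x).[z] - \sum_(i | neg i) b i.
pose A : pred (seq bool) := fun s => \sum_(i < n) `|b i| * (nth false s i)%:R == c.
have EA w (t : n.-tuple bool) : E w -> (forall i, X i w = v i (tnth t i)) -> A t.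
  move=> Ew Xt; rewrite /A /c -Ew linear_sum horner_sum eq_sym subr_eq.
  rewrite [X in _ == _ + X]big_mkcond -big_split/=; apply/eqP/eq_bigr => i _.
  rewrite linearZ hornerZ Xt (tnth_nth false) -/(b i) /v /neg.
  have [b0|b0] := ltP (b i) 0.
    by case: (nth _ _ _); rewrite /= ?mulr1 ?mulr0 ?mul1r ?mul0r ?ltr0_norm//; ring.
  by rewrite ger0_norm// addr0 addbF mulrC.
have antiA : antichain (size l) A.
  by rewrite sl; apply: antichain_level_set => i; rewrite normr_gt0 zn0.
have [m mE' lem] := bern_pgf_mode qlw.
apply: le_trans (prob_le_bern_expect indepX vI lawX mE EA) _.
apply: (@le_trans _ _ ((bern_pgf l)`_m)%:E).
  by rewrite lee_fin; apply: antichain_bern_expect_le => // j _; exact: lem.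
rewrite bern_pgf_two_valued.
apply: le_trans (coef_le_binomial_difference m p01 (binB k) (binB' k) (indepB k)) _.
apply: le_trans (le_bigmax _ _ k) => /=.
rewrite !big_cons big_nil.
(* The mean of [l] exceeds [mu_k] by the integer [k], so subtracting [k] from [m] gives the floor or
   the ceiling of [mu_k]. *)
have : m%:Z - #|neg|%:Z = Num.floor ((n%:R - 2 * #|neg|%:R) * p) \/
       m%:Z - #|neg|%:Z = Num.ceil ((n%:R - 2 * #|neg|%:R) * p).
  have kint : (#|neg|%:R : R) \is a Num.int by exact: natr_int.
  have floork : Num.floor (#|neg|%:R : R) = #|neg| := intrKfloor #|neg|%:Z.
  have ceilk : Num.ceil (#|neg|%:R : R) = #|neg| := intrKceil #|neg|%:Z.
  by case: mE' => ->; rewrite sum_two_valued; [left|right];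
    rewrite ?floorDrz ?ceilDrz// ?floork ?ceilk addrK.
by case=> ->; rewrite !le_max lexx ?orbT.
Qed.
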